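(* Let $n\geq 3$ be an integer and let $C_n\Box C_n$ be the Cartesian product of two cycles of length $n$, with the constant threshold $2$ at every vertex. Then $mon_2(C_n\Box C_n)=\dfrac{n^2}{3}$ if $n=3t$ for an integer $t$; $mon_2(C_n\Box C_n)\leq \dfrac{(n-1)(n+3)}{3}$ if $n=3t+1$ for an integer $t$; $mon_2(C_n\Box C_n)\leq \dfrac{(n+1)^2}{3}-1$ if $n=3t+2$ for an integer $t$.
   Context: All graphs are simple and undirected. The Cartesian product $G\Box H$ has vertex set $V(G)\times V(H)$, with $(u,v)$ adjacent to $(u',v')$ iff either $u=u'$ and $vv'\in E(H)$, or $v=v'$ and $uu'\in E(G)$. For a graph $G$ and a function $\tau:V(G)\to\mathbb{N}$ with $\tau(v)\le d_G(v)$, a set $M\subseteq V(G)$ is a $\tau$-monopoly if every vertex $v\in V(G)\setminus M$ has at least $\tau(v)$ neighbors in $M$; $mon_\tau(G)$ is the minimum size of a $\tau$-monopoly. When $\tau$ is constantly equal to $t$ one writes $mon_t(G)$. *)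

(* Defs.v *)
From mathcomp Require Import all_boot.

Set Implicit Arguments.
Unset Strict Implicit.
Unset Printing Implicit Defensive.

Record sgraph := SGraph {
  vertex :> finType;
  adj : rel vertex;
  adj_sym : symmetric adj;
  adj_irrefl : irreflexive adj
}.

Definition nbhd (G : sgraph) (v : G) : {set G} := [set w | adj v w].

Definition deg (G : sgraph) (v : G) : nat := #|nbhd v|.

Section CartesianProduct.
Variables G H : sgraph.

Definition cart_adj : rel (G * H) := fun x y =>
  (x.1 == y.1) && adj x.2 y.2 || (x.2 == y.2) && adj x.1 y.1.

Lemma cart_adj_sym : symmetric cart_adj.
Proof.
by move=> x y; rewrite /cart_adj (eq_sym x.1) (eq_sym x.2) (adj_sym x.1) (adj_sym x.2).
Qed.

Lemma cart_adj_irrefl : irreflexive cart_adj.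
Proof. by move=> x; rewrite /cart_adj !adj_irrefl !andbF. Qed.

Definition cart_prod : sgraph := SGraph cart_adj_sym cart_adj_irrefl.

End CartesianProduct.

Section Cycle.
Variable n : nat.

(* ordS is the successor modulo n; the conjunct i != j only matters for n = 1,
   where it removes the loop. This is the cycle C_n when 3 <= n. *)
Definition cycle_adj : rel 'I_n := fun i j =>
  (i != j) && ((j == ordS i) || (i == ordS j)).

Lemma cycle_adj_sym : symmetric cycle_adj.
Proof. by move=> i j; rewrite /cycle_adj eq_sym orbC. Qed.

Lemma cycle_adj_irrefl : irreflexive cycle_adj.
Proof. by move=> i; rewrite /cycle_adj eqxx. Qed.

Definition cycle_graph : sgraph := SGraph cycle_adj_sym cycle_adj_irrefl.

End Cycle.

Section Monopoly.
Variable G : sgraph.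

Definition threshold (tau : G -> nat) : Prop := forall v, tau v <= deg v.

Definition monopoly (tau : G -> nat) (M : {set G}) : bool :=
  [forall v in ~: M, tau v <= #|nbhd v :&: M|].

Definition mon (tau : G -> nat) : nat :=
  #|[arg min_(M < [set: G] | monopoly tau M) #|M|]|.

Lemma monopolyT (tau : G -> nat) : monopoly tau [set: G].
Proof. by apply/forall_inP => v; rewrite setCT inE. Qed.

Lemma monP (tau : G -> nat) :
  (exists2 M, monopoly tau M & #|M| = mon tau)
  /\ (forall M, monopoly tau M -> mon tau <= #|M|).
Proof.
rewrite /mon; case: arg_minnP => [|M mM leM]; first exact: monopolyT.
by split; first exists M.
Qed.

End Monopoly.

Definition mon_const (G : sgraph) (t : nat) : nat := mon (fun _ : G => t).

(* mon is total in tau; this shows that the constant threshold 2 is admissible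
   on the product of two cycles. *)
Lemma threshold_torus2 (n : nat) : 3 <= n ->
  threshold (fun _ : cart_prod (cycle_graph n) (cycle_graph n) => 2).
Proof.
move=> n3 [u v].
have neq1 (i : 'I_n) : i != ordS i.
  apply/eqP => /(congr1 val) /=; case: (ltngtP i.+1 n) (ltn_ord i) => // h _.
    by rewrite modn_small // => /n_Sn.
  by rewrite h modnn => i0; move: n3; rewrite -h i0.
have adjS (i : 'I_n) : cycle_adj i (ordS i) by rewrite /cycle_adj neq1 eqxx.
rewrite /deg.
have <- : #|[set (ordS u, v); (u, ordS v)]| = 2.
  by rewrite cards2 xpair_eqE eq_sym (negPf (neq1 u)).
apply/subset_leq_card/subsetP => -[a b]; rewrite !inE /= /cart_adj /=.
by case/orP => /eqP [-> ->]; rewrite /= eqxx adjS ?orbT.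
Qed.

(* Main.v *)
Require Import Defs.
From mathcomp Require Import all_boot all_order all_algebra.
From mathcomp Require Import zify ring.
Import GRing.Theory Num.Theory.

(** For the lower bound, double count the edges between a monopoly [M] and its
complement: [2 (n^2 - #|M|) <= 4 #|M|].  When [3 %| n] the diagonal pattern
[i + j = 0 mod 3] attains it.

When [n = 3 t + 1], one last row and one last column are glued to a diagonal
pattern on the [3t * 3t] square; they contain two out of every three vertices.
When [n = 3 t + 2], take the diagonal pattern on the torus of side [n + 1] and
identify its last two rows and its last two columns: the size is preserved,
except that the [2 * 2] corner contains two vertices of the pattern, which
become one. *)

Definition torus (n : nat) : sgraph := cart_prod (cycle_graph n) (cycle_graph n).

(** Encoded by a test rather than by [%% n], so that case analysis leaves goals that [lia] can
    settle. *)
Definition cyc_next (n i : nat) : nat := if i.+1 == n then 0 else i.+1.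
Definition cyc_prev (n i : nat) : nat := if i == 0 then n.-1 else i.-1.

Lemma val_ordS (n : nat) (i : 'I_n) : ordS i = cyc_next n i :> nat.
Proof.
rewrite /cyc_next /=; case: eqP => [->|/eqP ni]; first exact: modnn.
by rewrite modn_small // ltn_neqAle ni ltn_ord.
Qed.

Lemma val_ord_pred (n : nat) (i : 'I_n) : ord_pred i = cyc_prev n i :> nat.
Proof.
rewrite /cyc_prev /=; have := ltn_ord i; case: posnP => [->|i0] ltin.
  by rewrite add0n modn_small // prednK.
have -> : (i + n).-1 = i.-1 + n by lia.
by rewrite modnDr modn_small //; lia.
Qed.

Lemma ord_neq_ordS (n : nat) (i : 'I_n) : 3 <= n -> i != ordS i.
Proof.
move=> n3; apply/eqP => /(congr1 (@nat_of_ord n)); rewrite val_ordS /cyc_next.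
by case: eqP; lia.
Qed.

Lemma ordS_neq_ord_pred (n : nat) (i : 'I_n) : 3 <= n -> ordS i != ord_pred i.
Proof.
move=> n3; apply/eqP => /(congr1 (@nat_of_ord n)); rewrite val_ordS val_ord_pred.
rewrite /cyc_next /cyc_prev.
by have := ltn_ord i; do 2!case: eqP; lia.
Qed.

Lemma cycle_adjE (n : nat) (i j : 'I_n) : 3 <= n ->
  cycle_adj i j = (j == ordS i) || (j == ord_pred i).
Proof.
move=> n3; rewrite /cycle_adj (eq_sym j (ord_pred i)).
rewrite (can2_eq (@ord_predK n) (@ordSK n)).
have [<-|] //= := eqVneq i j.
by rewrite orbb (negPf (ord_neq_ordS _ i n3)).
Qed.

(** For [3 <= n] the four neighbours are pairwise distinct, so membership bits can be added without
    double counting. *)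
Lemma card_torus_nbhdI (n : nat) (i j : 'I_n) (M : {set torus n}) : 3 <= n ->
  #|nbhd ((i, j) : torus n) :&: M| =
  ((ordS i, j) \in M) + ((ord_pred i, j) \in M)
  + ((i, ordS j) \in M) + ((i, ord_pred j) \in M).
Proof.
move=> n3.
have neS : ordS i == i = false.
  by rewrite eq_sym (negPf (ord_neq_ordS _ i n3)).
have neP : ord_pred i == i = false.
  by rewrite (can2_eq (@ord_predK n) (@ordSK n)) (negPf (ord_neq_ordS _ i n3)).
have neSP (k : 'I_n) := negPf (ordS_neq_ord_pred _ k n3).
rewrite -sum1_card (eq_bigl (fun x => (x \in
  [:: (ordS i, j); (ord_pred i, j); (i, ordS j); (i, ord_pred j)])
  && (x \in M))); last first.
  move=> [a b]; rewrite !inE /= /cart_adj /= !cycle_adjE // !xpair_eqE.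
  rewrite (eq_sym i a) (eq_sym j b); congr (_ && _).
  by case: (a == i) (b == j) (a == ordS i) (a == ord_pred i) (b == ordS j)
    => [] [] [] [] [] //=; rewrite ?orbT ?orbF.
rewrite big_mkcondr -big_uniq /=; last first.
  by rewrite !inE !xpair_eqE !neSP neS neP !andbF.
by rewrite !big_cons big_nil /=; do 4!case: (_ \in M).
Qed.

Lemma torus_deg (n : nat) (v : torus n) : 3 <= n -> deg v = 4.
Proof.
by case: v => i j n3; rewrite /deg -[nbhd _]setIT card_torus_nbhdI // !inE.
Qed.

(** Each vertex outside [M] sends at least [t] edges into [M], and each vertex of [M] receives at
    most [d] of them. *)
Lemma monopoly_double_count (G : sgraph) (t d : nat) (M : {set G}) :
  (forall v : G, deg v <= d) -> monopoly (fun _ : G => t) M ->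
  t * (#|G| - #|M|) <= d * #|M|.
Proof.
move=> degd /forall_inP monM.
have -> : #|G| - #|M| = #|~: M| by rewrite [RHS]cardsCs setCK.
rewrite mulnC -sum_nat_const mulnC -sum_nat_const.
apply: (@leq_trans (\sum_(v in ~: M) #|nbhd v :&: M|)); first exact: leq_sum.
rewrite (eq_bigr (fun v => \sum_(w in M) adj v w)) => [|v _]; last first.
  rewrite -sum1_card big_mkcond [RHS]big_mkcond; apply: eq_bigr => w _.
  by rewrite !inE andbC; case: (w \in M); case: adj.
rewrite exchange_big /=; apply: leq_sum => w _; apply: leq_trans (degd w).
rewrite /deg -sum1_card [leqRHS]big_mkcond [leqLHS]big_mkcond.
by apply: leq_sum => v _; rewrite !inE adj_sym; case: (v \in M); case: adj.
Qed.

Lemma mon_torus_ge (n : nat) : 3 <= n -> n ^ 2 <= 3 * mon_const (torus n) 2.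
Proof.
move=> n3; have [[M monM cardM] _] := monP (fun _ : torus n => 2).
have := @monopoly_double_count (torus n) 2 4 M.
rewrite /mon_const -cardM card_prod card_ord => dc.
have {}dc := dc (fun v => eq_leq (torus_deg _ v n3)) monM.
by rewrite expnS expn1; lia.
Qed.

(** Reduces an upper bound to a local check on a pattern of natural-number coordinates, within reach
    of [lia]. *)
Lemma mon_torus_le (n : nat) (P : nat -> nat -> bool) : 3 <= n ->
  (forall i j, i < n -> j < n -> ~~ P i j ->
     2 <= P (cyc_next n i) j + P (cyc_prev n i) j
          + P i (cyc_next n j) + P i (cyc_prev n j)) ->
  mon_const (torus n) 2 <= \sum_(i < n) \sum_(j < n) P i j.
Proof.
move=> n3 monP'; have [_ minM] := monP (fun _ : torus n => 2).
have -> : \sum_(i < n) \sum_(j < n) P i j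
    = #|[set x : torus n | P (x.1 : 'I_n) (x.2 : 'I_n)]|.
  rewrite pair_big /= -sum1_card [RHS]big_mkcond; apply: eq_bigr => x _.
  by rewrite inE; case: (P _ _).
apply: minM; apply/forall_inP => -[i j]; rewrite !inE => nPij.
rewrite card_torus_nbhdI // !inE /fst /snd !val_ordS !val_ord_pred.
exact: monP'.
Qed.

Lemma sum_mod3 (t : nat) (f : nat -> nat) :
  \sum_(i < 3 * t) f (i %% 3) = t * (f 0 + f 1 + f 2).
Proof.
elim: t => [|t IHt]; first by rewrite muln0 big_ord0.
rewrite mulnS addnC addn3 !big_ord_recr /= IHt.
have -> : (3 * t) %% 3 = 0 by lia.
have -> : (3 * t).+1 %% 3 = 1 by lia.
have -> : (3 * t).+2 %% 3 = 2 by lia.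
by rewrite mulSn; lia.
Qed.

(** Adding [i] permutes the residues modulo 3, so each period contributes exactly one. *)
Lemma sum_diag (t i c : nat) : c < 3 ->
  \sum_(j < 3 * t) ((i + j) %% 3 == c) = t.
Proof.
move=> c3; under eq_bigr => j _ do rewrite -modnDmr.
by rewrite (sum_mod3 t (fun j => ((i + j) %% 3 == c))); lia.
Qed.

Lemma sum_mod3_neq (t c : nat) : c < 3 ->
  \sum_(j < 3 * t) (j %% 3 != c) = 2 * t.
Proof. by move=> c3; rewrite (sum_mod3 t (fun j => j != c)); lia. Qed.

Definition bordered (N : nat) (g : nat -> nat -> bool) (e : nat -> bool)
    (k : bool) (i j : nat) : bool :=
  if i < N then if j < N then g i j else e i else if j < N then e j else k.

Lemma sum_bordered (N : nat) (g : nat -> nat -> bool) (e : nat -> bool)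
    (k : bool) :
  \sum_(i < N.+1) \sum_(j < N.+1) bordered N g e k i j
  = \sum_(i < N) \sum_(j < N) g i j + 2 * \sum_(i < N) e i + k.
Proof.
rewrite big_ord_recr /= big_ord_recr /= /bordered ltnn.
under eq_bigr => i _ do rewrite big_ord_recr /= ltnn ltn_ord.
under eq_bigr => i _ do under eq_bigr => j _ do rewrite ltn_ord.
under [in X in _ + X]eq_bigr => i _ do rewrite ltn_ord.
by rewrite big_split /= mul2n -addnn !addnA.
Qed.

Lemma mon_torus0_le (t : nat) : 0 < t -> mon_const (torus (3 * t)) 2 <= 3 * t ^ 2.
Proof.
move=> t0; pose P i j := (i + j) %% 3 == 0.
apply: leq_trans (mon_torus_le (3 * t) P _ _) _; first by lia.
  (* If [i + j] is 1 mod 3 both predecessors lie in the pattern, if it is 2 both successors do;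
     wrapping around preserves residues since 3 divides the side. *)
  rewrite /P /cyc_next /cyc_prev => i j ltin ltjn.
  case: (i.+1 =P _) => ?; case: (j.+1 =P _) => ?;
  case: (i =P 0) => ?; case: (j =P 0) => ?; lia.
under eq_bigr => i _ do rewrite sum_diag //.
by rewrite sum_nat_const card_ord expnS expn1; lia.
Qed.

Lemma mon_torus1_le (t : nat) : 0 < t ->
  mon_const (torus (3 * t + 1)) 2 <= 3 * t ^ 2 + 4 * t.
Proof.
move=> t0.
(* Row [0] needs help from the border where [j] is 0 mod 3, and row [3 * t - 1] where [j] is 2. A
   border vertex at residue 1 then has both its border neighbours chosen, and so does the corner. *)
pose P := bordered (3 * t) (fun i j => (i + j) %% 3 == 2)
  (fun i => i %% 3 != 1) false.
apply: leq_trans (mon_torus_le (3 * t + 1) P _ _) _; first by lia.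
  rewrite /P /bordered /cyc_next /cyc_prev => i j ltin ltjn.
  case: (i.+1 =P _) => ?; case: (j.+1 =P _) => ?;
  case: (i =P 0) => ?; case: (j =P 0) => ?;
  do ?[case: (ltnP _ (3 * t)) => ?; try lia]; lia.
rewrite addn1 sum_bordered sum_mod3_neq //.
under eq_bigr => i _ do rewrite sum_diag //.
by rewrite sum_nat_const card_ord expnS expn1; lia.
Qed.

Lemma mon_torus2_le (t : nat) : 0 < t ->
  mon_const (torus (3 * t + 2)) 2 <= 3 * t ^ 2 + 6 * t + 2.
Proof.
move=> t0.
(* The merged rows [3 * t + 1] and [3 * t + 2] meet the diagonal pattern at residues 2 and 1, hence
   the border test [i %% 3 != 0]. *)
pose P := bordered (3 * t).+1 (fun i j => (i + j) %% 3 == 0)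
  (fun i => i %% 3 != 0) true.
apply: leq_trans (mon_torus_le (3 * t + 2) P _ _) _; first by lia.
  rewrite /P /bordered /cyc_next /cyc_prev => i j ltin ltjn.
  case: (i.+1 =P _) => ?; case: (j.+1 =P _) => ?;
  case: (i =P 0) => ?; case: (j =P 0) => ?;
  do ?[case: (ltnP _ (3 * t).+1) => ?; try lia]; lia.
rewrite addn2 sum_bordered.
(* The square has side [3 * t + 1]: each row has [t] full periods and one extra entry, in column
   [3 * t]. *)
under eq_bigr => i _ do rewrite big_ord_recr /= sum_diag //.
rewrite big_split /= sum_nat_const card_ord !big_ord_recr /=.
(* By symmetry the extra column is counted as a row of index [3 * t]. *)
under eq_bigr => i _ do rewrite addnC.
by rewrite sum_diag // sum_mod3_neq // expnS expn1; lia.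
Qed.

Local Open Scope ring_scope.

Theorem theorem1 (n : nat) (hn : (3 <= n)%N) :
  let m : rat := (mon_const (cart_prod (cycle_graph n) (cycle_graph n)) 2)%:R in
  [/\ (exists t : nat, n = (3 * t)%N) ->
        m = n%:R ^+ 2 / 3%:R,
      (exists t : nat, n = (3 * t + 1)%N) ->
        m <= (n%:R - 1) * (n%:R + 3%:R) / 3%:R
    & (exists t : nat, n = (3 * t + 2)%N) ->
        m <= (n%:R + 1) ^+ 2 / 3%:R - 1].
Proof.
move=> m; rewrite {}/m; set c := mon_const _ _.
have r3 : (3%:R : rat) != 0 by [].
split=> -[t nt].
- have cE : (3 * c)%N = (n ^ 2)%N.
    apply/eqP; rewrite eqn_leq mon_torus_ge // andbT.
    have cle : (c <= 3 * t ^ 2)%N by rewrite /c nt; apply: mon_torus0_le; lia.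
    by rewrite nt expnMn -[(3 ^ 2)%N]/(3 * 3)%N -mulnA leq_pmul2l.
  by apply: (canRL (mulfK r3)); rewrite mulrC -natrM cE natrX.
- have cle : (c <= 3 * t ^ 2 + 4 * t)%N.
    by rewrite /c nt; apply: mon_torus1_le; lia.
  (* The rational bound is exactly the size of the pattern, so nothing is lost to rounding. *)
  have -> : (n%:R - 1) * (n%:R + 3%:R) / 3%:R = (3 * t ^ 2 + 4 * t)%N%:R :> rat.
    by rewrite nt !natrD !natrM; field.
  by rewrite ler_nat.
- have cle : (c <= 3 * t ^ 2 + 6 * t + 2)%N.
    by rewrite /c nt; apply: mon_torus2_le; lia.
  have -> : (n%:R + 1) ^+ 2 / 3%:R - 1 = (3 * t ^ 2 + 6 * t + 2)%N%:R :> rat.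
    by rewrite nt !natrD !natrM; field.
  by rewrite ler_nat.
Qed.
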